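(* Let $A\neq B$ be two points of the Euclidean plane $\mathbb{R}^2$ (the locations of two different radars), and let $a,b\ge 0$ be real numbers. Then there are at most $4$ lines $\ell\subset\mathbb{R}^2$ such that the shortest distance from $A$ to $\ell$ equals $a$ and the shortest distance from $B$ to $\ell$ equals $b$. In other words, the shortest distances of the bomber's trajectory to two different radars determine the trajectory up to at most $4$ possibilities.
   Context: A single bomber flies in a horizontal plane, identified with $\mathbb{R}^2$, with constant speed and without changing direction, so its trajectory is a straight line $\ell$ in the plane. Radars are points of the plane at known locations. The shortest distance of the trajectory to a radar at $P$ is $\min_{x\in\ell}\|x-P\|$. *)

(* Defs.v *)
From mathcomp Require Import all_boot all_order all_algebra.
From mathcomp Require Import all_classical all_reals.

Set Implicit Arguments.
Unset Strict Implicit.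
Unset Printing Implicit Defensive.

Import Order.TTheory GRing.Theory Num.Theory.

Local Open Scope classical_set_scope.
Local Open Scope ring_scope.

(* The norm `|x| that MathComp-Analysis puts on 'rV[R]_2 is the sup norm, hence
   an explicit Euclidean norm. *)
Definition enorm (R : realType) (x : 'rV[R]_2) : R :=
  Num.sqrt (\sum_(i < 2) x ord0 i ^+ 2).

(* A line is the set of its points: two parametrizations with the same image
   give the same line. *)
Definition is_line (R : realType) (l : set 'rV[R]_2) : Prop :=
  exists p v : 'rV[R]_2, v != 0 /\ l = [set p + t *: v | t in [set: R]].

(* d = min_(x in l) |x - P|, with the minimum required to be attained. *)
Definition is_shortest_dist (R : realType) (l : set 'rV[R]_2) (P : 'rV[R]_2)
    (d : R) : Prop :=
  let D := [set enorm (x - P) | x in l] in D d /\ lbound D d.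

(* Main.v *)
Require Import Defs.
From mathcomp Require Import all_boot all_order all_algebra.
From mathcomp Require Import all_classical all_reals.
From mathcomp Require Import ring lra.

(** A line [l] has a unit normal [n], so [l] is [n . x = c], and the signed
distances [n . A - c] and [n . B - c] are [a] and [b] up to sign. Replacing
[(n, c)] by [(- n, - c)] makes the first one equal to [a]. Then [n . (A - B)] is
[a - b] or [a + b], and each value leaves at most two unit vectors [n], mirror
images of each other in the line directed by [A - B]. *)

Set Implicit Arguments.
Unset Strict Implicit.
Unset Printing Implicit Defensive.

Import Order.TTheory GRing.Theory Num.Theory.

Local Open Scope classical_set_scope.
Local Open Scope card_scope.
Local Open Scope ring_scope.

Definition dot (R : realType) (x y : 'rV[R]_2) : R :=
  \sum_(i < 2) x ord0 i * y ord0 i.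

Definition rot (R : realType) (x : 'rV[R]_2) : 'rV[R]_2 :=
  \row_j (if j == ord0 then - x ord0 ord_max else x ord0 ord0).

Definition normal_line (R : realType) (n : 'rV[R]_2) (c : R) :
  set 'rV[R]_2 := [set x | dot n x = c].

Section Plane.
Variable R : realType.
Implicit Types (x y n : 'rV[R]_2) (l : set 'rV[R]_2) (c d k : R).

Lemma dotE x y :
  dot x y = x ord0 ord0 * y ord0 ord0 + x ord0 ord_max * y ord0 ord_max.
Proof.
rewrite /dot big_ord_recl big_ord1; congr (_ + _ * _);
  by congr (_ ord0 _); apply/val_inj.
Qed.

Lemma row2P x y : x ord0 ord0 = y ord0 ord0 ->
  x ord0 ord_max = y ord0 ord_max -> x = y.
Proof.
move=> e0 e1; apply/rowP => -[[|[|//]] lti].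
- by rewrite (_ : Ordinal lti = ord0) //; apply/val_inj.
- by rewrite (_ : Ordinal lti = ord_max) //; apply/val_inj.
Qed.

Lemma dot_sqr_gt0 x : x != 0 -> 0 < dot x x.
Proof.
move=> x0; rewrite dotE -!expr2 lt_neqAle addr_ge0 ?sqr_ge0 // andbT eq_sym.
rewrite paddr_eq0 ?sqr_ge0 // !sqrf_eq0; apply: contra x0 => /andP[/eqP x0 /eqP x1].
by apply/eqP/row2P; rewrite mxE.
Qed.

Lemma enormE x : enorm x = Num.sqrt (dot x x).
Proof. by congr Num.sqrt; apply: eq_bigr => i _; rewrite expr2. Qed.

Lemma normal_lineN n c : normal_line (- n) (- c) = normal_line n c.
Proof.
apply/seteqP; split => x; rewrite /normal_line /= !dotE !mxE => h; lra.
Qed.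

Lemma dotNN n : dot (- n) (- n) = dot n n.
Proof. by rewrite !dotE !mxE; ring. Qed.

(** [x] and its quarter turn [rot x] are orthogonal and of equal length. Scaling by [dot x x] avoids
    dividing by the squared length. *)
Lemma rot_decomp x y :
  dot x x *: y = dot y x *: x + dot y (rot x) *: rot x.
Proof. by apply/row2P; rewrite !dotE !mxE /=; ring. Qed.

(** The normal is the direction vector turned by a right angle and normalized. *)
Lemma is_line_normal l :
  is_line l -> exists n c, dot n n = 1 /\ l = normal_line n c.
Proof.
move=> [p [v [v0 ->]]]; have q0 := dot_sqr_gt0 v0.
have s0 : Num.sqrt (dot v v) != 0 by rewrite gt_eqF // sqrtr_gt0.
have s2 := sqr_sqrtr (ltW q0); set s := Num.sqrt _ in s0 s2.
have dotZ x : dot (s^-1 *: rot v) x = s^-1 * dot (rot v) x.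
  by rewrite !dotE !mxE; ring.
exists (s^-1 *: rot v), (dot (s^-1 *: rot v) p); split.
  transitivity (dot v v / s ^+ 2); last by rewrite s2 divff // gt_eqF.
  by rewrite !dotE !mxE /=; field.
apply/seteqP; split => [_ [t _ <-]|x]; rewrite /normal_line /= !dotZ.
  by rewrite !dotE !mxE /=; ring.
move=> /mulfI h; have {}h := h (invr_neq0 s0).
(* By [h], [x - p] has no component along [rot v], so it equals its projection onto [v]. *)
exists (dot (x - p) v / dot v v) => //.
suff -> : (dot (x - p) v / dot v v) *: v = x - p by rewrite addrC subrK.
apply: (scalerI (lt0r_neq0 q0)); rewrite [RHS]rot_decomp scalerA mulrC divfK ?gt_eqF //.
have -> : dot (x - p) (rot v) = dot (rot v) x - dot (rot v) p.
  by rewrite !dotE !mxE; ring.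
by rewrite h subrr scale0r addr0.
Qed.

Lemma shortest_dist_normal_line n c x d : dot n n = 1 ->
  is_shortest_dist (normal_line n c) x d -> `|dot n x - c| = d.
Proof.
move=> n1 [[y yl <-] lb]; apply/le_anti/andP; split.
(* Cauchy-Schwarz for [n] and [y - x]: once the right side is multiplied by [dot n n = 1], the two
   sides differ by the square of a determinant (Lagrange's identity). *)
- rewrite enormE -sqrtr_sqr; apply: ler_wsqrtr.
  rewrite -yl; move: n1; rewrite !dotE !mxE.
  set n0 := n _ _; set n2 := n _ _ => n1.
  have -> : forall u v : R, u * u + v * v = (n0 * n0 + n2 * n2) * (u * u + v * v).
    by move=> u v; rewrite n1 mul1r.
  rewrite -subr_ge0; set e := (X in 0 <= X).
  have -> : e = (n0 * (y ord0 ord_max - x ord0 ord_max)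
    - n2 * (y ord0 ord0 - x ord0 ord0)) ^+ 2 by rewrite /e; ring.
  exact: sqr_ge0.
- pose e := dot n x - c.
  (* The foot of the perpendicular from [x] lies on the line at distance [|e|]. *)
  apply: lb; exists (x - e *: n).
    rewrite /normal_line /= /e; move: n1; rewrite !dotE !mxE.
    set n0 := n _ _; set n2 := n _ _ => n1.
    transitivity (c + (1 - (n0 * n0 + n2 * n2)) *
      (n0 * x ord0 ord0 + n2 * x ord0 ord_max - c)); first by ring.
    by rewrite n1; ring.
  rewrite enormE -sqrtr_sqr; congr Num.sqrt.
  transitivity (e ^+ 2 * dot n n); last by rewrite n1 mulr1.
  by rewrite !dotE !mxE; ring.
Qed.

(* [sg] chooses between the two mirror images. *)
Definition unit_with_dot x k (sg : bool) : 'rV[R]_2 :=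
  (dot x x)^-1 *:
    (k *: x + ((-1) ^+ sg * Num.sqrt (dot x x - k ^+ 2)) *: rot x).

(** The component of [n] along [x] is prescribed; by Pythagoras the one along [rot x] is then known
    up to sign, and [sg] records that sign. *)
Lemma unit_with_dotP x n k : x != 0 -> dot n n = 1 -> dot n x = k ->
  exists sg, n = unit_with_dot x k sg.
Proof.
move=> x0 n1 <-; have q0 := lt0r_neq0 (dot_sqr_gt0 x0).
have e : dot x x - dot n x ^+ 2 = dot n (rot x) ^+ 2.
  rewrite -[dot x x]mul1r -n1 !dotE !mxE /=; ring.
exists (dot n (rot x) < 0); rewrite /unit_with_dot e sqrtr_sqr -numEsign.
apply: (scalerI q0); rewrite scalerA divff // scale1r.
exact: rot_decomp.
Qed.

End Plane.

Theorem theorem6p1 (R : realType) (A B : 'rV[R]_2) (a b : R)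
  (AB : A <> B) (a0 : 0 <= a) (b0 : 0 <= b) :
  [set l : set 'rV[R]_2 | [/\ is_line l, is_shortest_dist l A a
                            & is_shortest_dist l B b]] #<= `I_4.
Proof.
(* The offset is forced by the normalization [dot n A - c = a]. *)
pose line k sg := let n := unit_with_dot (A - B) k sg in
  normal_line n (dot n A - a).
(* The parity of [i] selects the value of [dot n (A - B)], and [1 < i] the mirror image. It suffices
   that these four candidates cover all solutions. *)
pose f i := line (if odd i then a - b else a + b) (1 < i)%N.
apply: (card_le_trans _ (card_image_le f `I_4)).
apply: subset_card_le => l [ll lA lB].
have D0 : A - B != 0 by rewrite subr_eq0; apply/eqP.
have [n [c [n1 lE nA]]] : exists n c,
    [/\ dot n n = 1, l = normal_line n c & dot n A - c = a].
  have [n [c [n1 lE]]] := is_line_normal ll; rewrite lE in lA.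
  have /eqP := shortest_dist_normal_line n1 lA.
  rewrite eqr_norml a0 andbT => /orP[/eqP nA|/eqP nA]; first by exists n, c.
  exists (- n), (- c); rewrite dotNN normal_lineN; split=> //.
  move: nA; rewrite !dotE !mxE => nA; lra.
have hit k : dot n (A - B) = k -> exists sg, l = line k sg.
  move=> /(unit_with_dotP D0 n1)[s nE]; exists s.
  by rewrite /line -nE lE -nA subKr.
rewrite lE in lB; have /eqP := shortest_dist_normal_line n1 lB.
have dotB : dot n (A - B) = dot n A - dot n B by rewrite !dotE !mxE; ring.
rewrite eqr_norml b0 andbT => /orP[/eqP nB|/eqP nB].
- have [|[] ->] := hit (a - b); first by rewrite dotB; lra.
  + by exists 3%N.
  + by exists 1%N.
- have [|[] ->] := hit (a + b); first by rewrite dotB; lra.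
  + by exists 2%N.
  + by exists 0%N.
Qed.
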